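(* Let $\mathcal{A}\in\mathbb{R}^{[m,n]}$ be a Nekrasov $Z$-tensor all of whose diagonal entries are positive. Then $\mathcal{A}$ is a $B$-Nekrasov tensor.
   Context: $[n]=\{1,\dots,n\}$, and $\mathbb{R}^{[m,n]}$ is the set of real tensors $\mathcal{A}=(a_{i_1\cdots i_m})$ of order $m\ge 2$ and dimension $n$, with each $i_l\in[n]$. The diagonal entries are $a_{ii\cdots i}$; all other entries are off-diagonal. Decomposition: for $\mathcal{A}\in\mathbb{R}^{[m,n]}$ and $i\in[n]$, let $r_i^+=\max\left(\{0\}\cup\{a_{ii_2\cdots i_m}: i_2,\dots,i_m\in[n],\ (i_2,\dots,i_m)\neq(i,\dots,i)\}\right)$. Write $\mathcal{A}=\mathcal{B}^++\mathcal{C}$, where $\mathcal{B}^+=(b^+_{i_1\cdots i_m})$ and $\mathcal{C}=(c_{i_1\cdots i_m})$ have entries $b^+_{ii_2\cdots i_m}=a_{ii_2\cdots i_m}-r_i^+$ and $c_{ii_2\cdots i_m}=r_i^+$ for all $i,i_2,\dots,i_m\in[n]$. For a tensor $\mathcal{T}=(t_{i_1\cdots i_m})$ of order $m$ and dimension $n$ with nonzero diagonal entries, define recursively $\Lambda_1(\mathcal{T})=\sum_{(i_2,\dots,i_m)\neq(1,\dots,1)}|t_{1i_2\cdots i_m}|$ and, for $i=2,\dots,n$, $$\Lambda_i(\mathcal{T})=\sum_{(i_2,\dots,i_m)\in[i-1]^{m-1}}|t_{ii_2\cdots i_m}|\prod_{l=2}^{m}\left(\frac{\Lambda_{i_l}(\mathcal{T})}{|t_{i_li_l\cdots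 i_l}|}\right)^{\frac1{m-1}}+\sum_{\substack{(i_2,\dots,i_m)\in[n]^{m-1}\setminus[i-1]^{m-1}\\(i_2,\dots,i_m)\neq(i,\dots,i)}}|t_{ii_2\cdots i_m}|.$$ $\mathcal{T}$ is a Nekrasov tensor if its diagonal entries are nonzero and $|t_{ii\cdots i}|>\Lambda_i(\mathcal{T})$ for all $i\in[n]$. A $Z$-tensor is a real tensor all of whose off-diagonal entries are nonpositive. A Nekrasov $Z$-tensor is a real tensor that is both a Nekrasov tensor and a $Z$-tensor. $\mathcal{A}\in\mathbb{R}^{[m,n]}$ is a $B$-Nekrasov tensor if, in the decomposition $\mathcal{A}=\mathcal{B}^++\mathcal{C}$ with $b^+_{ii_2\cdots i_m}=a_{ii_2\cdots i_m}-r_i^+$ and $c_{ii_2\cdots i_m}=r_i^+$, $\mathcal{B}^+$ is a Nekrasov $Z$-tensor whose diagonal entries are all positive. *)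

(* Defs.v *)
From mathcomp Require Import all_boot all_order all_algebra.
From mathcomp Require Import reals exp.
Set Implicit Arguments.
Unset Strict Implicit.
Unset Printing Implicit Defensive.
Import Order.TTheory GRing.Theory Num.Theory.
Local Open Scope ring_scope.

(* The entry a_{i i_2 ... i_m} is A (i, t) with t = (i_2, ..., i_m), a tuple of
   length m - 1. This reading requires m >= 1; indices start at 0 instead of 1. *)
Definition tensor (R : realType) (m n : nat) :=
  {ffun 'I_n * m.-1.-tuple 'I_n -> R}.

Section Tensors.
Variables (R : realType) (m n : nat).
Implicit Types (A T : tensor R m n) (i : 'I_n) (t : m.-1.-tuple 'I_n).

Definition diag_tail i : m.-1.-tuple 'I_n := nseq_tuple m.-1 i.

Definition diag T i : R := T (i, diag_tail i).

Definition Z_tensor T : Prop := forall i t, t != diag_tail i -> T (i, t) <= 0.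

Definition Lambda_step T (L : 'I_n -> R) i : R :=
  \sum_(t : m.-1.-tuple 'I_n | all (fun j : 'I_n => (j < i)%N) t)
     `|T (i, t)| * \prod_(l < m.-1)
        (L (tnth t l) / `|diag T (tnth t l)|) `^ (m.-1%:R)^-1
  + \sum_(t : m.-1.-tuple 'I_n |
          ~~ all (fun j : 'I_n => (j < i)%N) t && (t != diag_tail i))
     `|T (i, t)|.

(* Lambda_step at i only uses the values of L at indices below i, so after n
   iterations the values are those of the recursion, whatever the initial
   function: see LambdaE and Lambda_first. *)
Definition Lambda T : 'I_n -> R := iter n (Lambda_step T) (fun=> 0).

Lemma Lambda_step_local T (L L' : 'I_n -> R) i :
  (forall j : 'I_n, (j < i)%N -> L j = L' j) ->
  Lambda_step T L i = Lambda_step T L' i.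
Proof.
move=> eqL; congr (_ + _); apply: eq_bigr => t /all_tnthP lt_ti.
by congr (_ * _); apply: eq_bigr => l _; rewrite eqL.
Qed.

Lemma LambdaE T i : Lambda T i = Lambda_step T (Lambda T) i.
Proof.
have stable k (j : 'I_n) : (j < k)%N ->
    iter k.+1 (Lambda_step T) (fun=> 0) j = iter k (Lambda_step T) (fun=> 0) j.
  elim: k j => // k IHk j lt_jk.
  apply: (@Lambda_step_local T (iter k.+1 _ _) (iter k _ _)) => j' lt_j'j.
  by apply: IHk; apply: leq_trans lt_j'j _.
by rewrite /Lambda -[RHS]/(iter n.+1 (Lambda_step T) (fun=> 0) i) stable.
Qed.

Lemma Lambda_first T i : (1 < m)%N -> i = 0%N :> nat ->
  Lambda T i = \sum_(t : m.-1.-tuple 'I_n | t != diag_tail i) `|T (i, t)|.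
Proof.
move=> m_gt1 i0; rewrite LambdaE /Lambda_step i0.
have noall t : all (fun j : 'I_n => (j < 0)%N) t = false.
  by case: t => [[|x s] /= /eqP]; case: (m) m_gt1 => [|[]].
rewrite big_pred0 ?add0r //; by apply: eq_bigl => t; rewrite noall.
Qed.

Definition Nekrasov T : Prop :=
  (forall i, diag T i != 0) /\ (forall i, Lambda T i < `|diag T i|).

Definition Nekrasov_Z T : Prop := Nekrasov T /\ Z_tensor T.

Definition rplus A i : R :=
  \big[Num.max/0]_(t : m.-1.-tuple 'I_n | t != diag_tail i) A (i, t).

Definition Cpart A : tensor R m n := [ffun p => rplus A p.1].

Definition Bplus A : tensor R m n := [ffun p => A p - rplus A p.1].

Lemma BplusDCpart A : A = Bplus A + Cpart A.
Proof. by apply/ffunP => p; rewrite !ffunE subrK. Qed.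

Definition B_Nekrasov A : Prop :=
  Nekrasov_Z (Bplus A) /\ (forall i, 0 < diag (Bplus A) i).

End Tensors.

(* Main.v *)
Require Import Defs.
From mathcomp Require Import all_boot all_order all_algebra.
From mathcomp Require Import reals exp.
Import Order.TTheory GRing.Theory Num.Theory.
Local Open Scope ring_scope.

(** The off-diagonal entries of a Z-tensor are nonpositive, so the maximum
    [rplus] of [0] and these entries vanishes in every row.  Hence nothing is
    subtracted in the decomposition: the tensor is its own B-plus part, which
    inherits all the required properties. *)

Lemma rplus_Z_tensor (R : realType) (m n : nat) (A : tensor R m n) (i : 'I_n) :
  Z_tensor A -> rplus A i = 0.
Proof.
move=> ZA; rewrite /rplus.
elim/big_rec: _ => // t x off_t ->.
by apply: max_r; apply: ZA.
Qed.

Lemma Bplus_Z_tensor (R : realType) (m n : nat) (A : tensor R m n) :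
  Z_tensor A -> Bplus A = A.
Proof. by move=> ZA; apply/ffunP => p; rewrite ffunE rplus_Z_tensor // subr0. Qed.

Theorem proposition2 (R : realType) (m n : nat) (hm : (2 <= m)%N)
    (A : tensor R m n) (hA : Nekrasov_Z A)
    (hdiag : forall i : 'I_n, 0 < diag A i) :
  B_Nekrasov A.
Proof. by rewrite /B_Nekrasov Bplus_Z_tensor //; case: hA. Qed.
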